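(* Let $n\ge 1$. For $a,b\in\widehat{\mathcal F_n}$ put $\mathrm d(a,b)=2^{-\min\{i\in\mathbb N\,\mid\, a\cap K_n^i\ne b\cap K_n^i\}}$, with the convention $2^{-\min\emptyset}=0$. Then $(\widehat{\mathcal F_n},\mathrm d)$ is a compact Hausdorff metric space. The metric topology is the profinite topology, and the Heyting algebra operations are continuous. Moreover, $\widehat{\mathcal F_n}$ is the metric completion of its dense subset $\mathcal F_n$.
   Context: Fix $n\ge1$ and symbols $P_1,\dots,P_n$. The partially ordered set $(K_n,\le)$ with valuation map $\mathrm{val}:K_n\to\mathfrak P(\{P_1,\dots,P_n\})$ is the increasing union of finite sets $K_n^d$ ($d\ge 0$) built recursively: $K_n^{-1}=\emptyset$, and $K_n^d\setminus K_n^{d-1}$ consists of exactly one point $w_{\beta,Y}$ for each pair $(\beta,Y)$ such that (i) $Y$ is a decreasing subset of $K_n^{d-1}$ with $Y\not\subseteq K_n^{d-2}$ (for $d=0$ this last condition is void, so $Y=\emptyset$); (ii) $\beta\subseteq\{P_1,\dots,P_n\}$ and $\beta\subseteq\mathrm{val}(w')$ for all $w'\in Y$; (iii) if $Y$ is the decreasing set generated by a single element $w_{\beta',Y'}$, then $\beta\ne\beta'$. One sets $\mathrm{val}(w_{\beta,Y})=\beta$, and $w\le w_{\beta,Y}$ iff $w\in Y$ or $w=w_{\beta,Y}$. $\widehat{\mathcal F_n}:=\mathcal O_\downarrow(K_n,\le)$ is the Heyting algebra of all decreasing subsets of $K_n$ ($\sqcap=\cap$, $\sqcup=\cup$, $a\to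 b$ = the largest decreasing set contained in $(K_n\setminus a)\cup b$). By a theorem of Bellissima, the Heyting sub-algebra of $\widehat{\mathcal F_n}$ generated by $g_i=\{w\in K_n: P_i\in\mathrm{val}(w)\}$, $i=1,\dots,n$, is free on $g_1,\dots,g_n$; the free Heyting algebra $\mathcal F_n$ is identified with it. The profinite topology on $\widehat{\mathcal F_n}$ is the initial topology for the maps $\widehat\pi_i:\widehat{\mathcal F_n}\to\mathcal O_\downarrow(K_n^i,\le)$, $a\mapsto a\cap K_n^i$ ($i\in\mathbb N$), where the finite targets carry the discrete topology ($\widehat{\mathcal F_n}$ being the projective limit of these finite Heyting algebras). *)

(* Defs.v *)
From HB Require Import structures.
From mathcomp Require Import all_boot all_order all_algebra finmap.
From mathcomp Require Import all_classical all_reals all_analysis.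

Set Implicit Arguments.
Unset Strict Implicit.
Unset Printing Implicit Defensive.

Import Order.TTheory GRing.Theory Num.Theory.

Local Open Scope classical_set_scope.

(* The symbols P_1, ..., P_n are the elements of 'I_n.  The points w_(beta, Y)
are taken in a type of labelled finite trees: [node beta Y] is the tree with
label beta whose children are an enumeration of the finite set Y.  The type
[point n] also contains junk; K_n is the subset [Kn n] carved out below.
Every stage of K_n is finite ([finite_Kpred]), so letting Y range over {fset _}
loses no subset of a stage. *)

Inductive point (n : nat) : Type := Point of {set 'I_n} & seq (point n).

HB.instance Definition _ n := gen_eqMixin (point n).
HB.instance Definition _ n := gen_choiceMixin (point n).

Section Poset.
Variable n : nat.
Implicit Types (w : point n) (beta : {set 'I_n}) (Y : {fset point n}).

Definition node beta Y : point n := Point beta (enum_fset Y).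

Definition valuation w : {set 'I_n} := let: Point beta _ := w in beta.

Definition below w : set (point n) :=
  let: Point _ s := w in [set w' | w' \in s].

Definition ple w w' : Prop := below w' w \/ w = w'.

Definition decreasing_in (D : set (point n)) : set (set (point n)) :=
  [set a | a `<=` D /\ forall w w', D w -> ple w w' -> a w' -> a w].

Definition layer (K1 : set (point n)) (fresh : set (point n) -> Prop) :
    set (point n) :=
  [set w | exists beta Y, w = node beta Y /\
     [/\ decreasing_in K1 [set` Y],
         fresh [set` Y],
         (forall w', w' \in Y -> beta \subset valuation w') &
         (forall w', [set` Y] = [set v | ple v w'] -> beta <> valuation w')]].

(* [Kpred d] is K_n^(d-1), so that [Kpred 0] is K_n^(-1) *)
Fixpoint Kpred (k : nat) : set (point n) :=
  if k is d.+1 then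
    Kpred d `|` layer (Kpred d)
      (fun Z => if d is e.+1 then ~ (Z `<=` Kpred e) else True)
  else set0.

Definition Kstage (d : nat) : set (point n) := Kpred d.+1.

Definition Kn : set (point n) := \bigcup_d Kstage d.

(* [node_inj] and [layer_fresh]: the points of K_n^d \ K_n^(d-1) are in bijection
   with the admissible pairs (beta, Y) *)
Lemma node_inj beta Y beta' Y' :
  node beta Y = node beta' Y' -> beta = beta' /\ Y = Y'.
Proof. by case=> -> /val_inj ->. Qed.

Lemma below_node beta Y : below (node beta Y) = [set` Y].
Proof. by []. Qed.

Lemma KpredS d : Kpred d `<=` Kpred d.+1.
Proof. by move=> w; left. Qed.

Lemma subset_Kpred d e : (d <= e)%N -> Kpred d `<=` Kpred e.
Proof.
move=> /subnK <-; elim: (e - d)%N => [|k IH] w Kw; first by rewrite add0n.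
by rewrite addSn; apply/KpredS/IH.
Qed.

Lemma KpredP d w : Kpred d w ->
  exists2 e, (e < d)%N & layer (Kpred e)
    (fun Z => if e is f.+1 then ~ (Z `<=` Kpred f) else True) w.
Proof.
elim: d => // d IH [/IH[e ed we]|wd]; last by exists d.
by exists e => //; exact: ltnW.
Qed.

Lemma layer_fresh d w :
  layer (Kpred d) (fun Z => if d is e.+1 then ~ (Z `<=` Kpred e) else True) w ->
  ~ Kpred d w.
Proof.
move=> [beta [Y [-> [[YK _] Yf _ _]]]] /KpredP[e ed].
move=> [beta' [Y' [/node_inj[_ <-] [[Y'K _] _ _ _]]]].
case: d ed Yf YK => // d; rewrite ltnS => ed Yf _.
by apply: Yf; apply: subset_trans Y'K _; exact: subset_Kpred.
Qed.

Lemma ple_Kpred d w w' : Kpred d w' -> ple w w' -> Kpred d w.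
Proof.
move=> /[dup] dw' /KpredP[e ed [beta [Y [wE [[YK _] _ _ _]]]]] [|->//].
by rewrite wE => /YK; apply: subset_Kpred; exact: ltnW.
Qed.

Lemma ple_refl w : ple w w. Proof. by right. Qed.

Lemma ple_trans_Kn w1 w2 w3 : Kn w3 -> ple w1 w2 -> ple w2 w3 -> ple w1 w3.
Proof.
move=> [d _ /KpredP[e ed [beta [Y [-> [[YK Yd] _ _ _]]]]]] w12 [w23|<-//].
left; rewrite below_node; apply: (Yd _ w2) => //.
by apply: ple_Kpred w12; exact: YK.
Qed.

Lemma ple_anti w1 w2 : ple w1 w2 -> ple w2 w1 -> w1 = w2.
Proof.
pose fix height (w : point n) : nat :=
  let: Point _ s := w in (foldr (fun v m => height v + m) 0 s).+1%N.
have lt_height v w : below w v -> (height v < height w)%N.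
  case: w => b s /=; rewrite ltnS; elim: s => //= u s IH.
  rewrite inE => /orP[/eqP ->|/IH]; first exact: leq_addr.
  by move=> /leq_trans; apply; exact: leq_addl.
move=> [/lt_height h12|//] [/lt_height h21|//].
by have := ltn_trans h12 h21; rewrite ltnn.
Qed.

Lemma finite_Kpred d : finite_set (Kpred d).
Proof.
elim: d => [|d /finite_fsetP[X XE]]; first exact: finite_set0.
rewrite /= finite_setU; split; first by rewrite XE; exact: finite_fset.
apply: (@sub_finite_set _ _
  [set node p.1 p.2 | p in [set: {set 'I_n}] `*` [set` fpowerset X]]).
  move=> w [beta [Y [-> [[YK _] _ _ _]]]]; exists (beta, Y) => //=.
  split=> //=; rewrite fpowersetE; apply/fsubsetP => v vY.
  by have := YK v vY; rewrite XE.
by apply: finite_image; apply: finite_setX => //; exact: finite_fset.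
Qed.

Definition downset (D : set (point n)) : Type :=
  {a : set (point n) | a \in decreasing_in D}.

HB.instance Definition _ D := Choice.on (downset D).

Definition carrier D (a : downset D) : set (point n) := val a.

Lemma downsetP D (a : downset D) : decreasing_in D (carrier a).
Proof. exact/set_mem/(valP a). Qed.

Definition mk_downset D (a : set (point n)) (ha : decreasing_in D a) :
  downset D := exist _ a (mem_set ha).

Lemma downset_inj D : injective (@carrier D).
Proof. exact: val_inj. Qed.

Section Heyting.
Variable D : set (point n).
Implicit Types a b c : downset D.

Lemma dbot_subproof : decreasing_in D set0.
Proof. by split. Qed.
Definition dbot : downset D := mk_downset dbot_subproof.

Lemma dtop_subproof : decreasing_in D D.
Proof. by split. Qed.
Definition dtop : downset D := mk_downset dtop_subproof.

Lemma dmeet_subproof a b : decreasing_in D (carrier a `&` carrier b).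
Proof.
have [[aD ad] [_ bd]] := (downsetP a, downsetP b).
split=> [w [/aD]//|w w' Dw ww' [aw' bw']].
by split; [exact: ad ww' aw'|exact: bd ww' bw'].
Qed.
Definition dmeet a b : downset D := mk_downset (dmeet_subproof a b).

Lemma djoin_subproof a b : decreasing_in D (carrier a `|` carrier b).
Proof.
have [[aD ad] [bD bd]] := (downsetP a, downsetP b).
split=> [w [/aD|/bD]//|w w' Dw ww' [aw'|bw']].
- by left; exact: ad ww' aw'.
- by right; exact: bd ww' bw'.
Qed.
Definition djoin a b : downset D := mk_downset (djoin_subproof a b).

(* the union of all decreasing sets contained in (D \ a) u b; it is the
   largest such set by [dimp_largest] *)
Definition dimp_set a b : set (point n) :=
  \bigcup_(c in [set c | decreasing_in D c /\
                         c `<=` (D `\` carrier a) `|` carrier b]) c.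

Lemma dimp_subproof a b : decreasing_in D (dimp_set a b).
Proof.
split=> [w [c [[cD _] _]]|w w' Dw ww' [c [[cD cd] cab] cw']]; first exact: cD.
by exists c => //; exact: cd ww' cw'.
Qed.
Definition dimp a b : downset D := mk_downset (dimp_subproof a b).

Lemma dimp_largest a b :
  carrier (dimp a b) `<=` (D `\` carrier a) `|` carrier b /\
  forall c, carrier c `<=` (D `\` carrier a) `|` carrier b ->
    carrier c `<=` carrier (dimp a b).
Proof.
split=> [w [c [_ cab]]|c cab w cw]; first exact: cab.
by exists (carrier c) => //; split=> //; exact: downsetP.
Qed.

End Heyting.

End Poset.

Arguments Kpred n k : clear implicits.
Arguments Kstage n d : clear implicits.
Arguments Kn n : clear implicits.
Arguments dbot {n} D.
Arguments dtop {n} D.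

Definition Fhat (n : nat) : Type := downset (Kn n).

HB.instance Definition _ n := Choice.on (Fhat n).

Section FreeHeyting.
Variable n : nat.
Implicit Types a b c : Fhat n.

Lemma Fgen_subproof (i : 'I_n) :
  decreasing_in (Kn n) [set w | Kn n w /\ i \in valuation w].
Proof.
split=> [w []//|w w' Kw [ww'|->//] [Kw' iw']]; split=> //.
case: Kw' => d _ /KpredP[e _ [beta [Y [w'E [_ _ bY _]]]]].
by move: ww' iw'; rewrite w'E => /bY/fintype.subsetP; exact.
Qed.
Definition Fgen (i : 'I_n) : Fhat n := mk_downset (Fgen_subproof i).

Definition heyting_subalgebra (S : set (Fhat n)) : Prop :=
  [/\ S (dbot (Kn n)), S (dtop (Kn n)),
      (forall a b, S a -> S b -> S (dmeet a b)),
      (forall a b, S a -> S b -> S (djoin a b)) &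
      (forall a b, S a -> S b -> S (dimp a b))].

Definition Fn : set (Fhat n) := smallest heyting_subalgebra (range Fgen).

Lemma Fproj_subproof i a : decreasing_in (Kstage n i) (carrier a `&` Kstage n i).
Proof.
have [aK ad] := downsetP a; split=> [w []//|w w' Kw ww' [aw' _]].
by split=> //; apply: ad ww' aw'; exists i.
Qed.
Definition Fproj (i : nat) a : downset (Kstage n i) :=
  mk_downset (Fproj_subproof i a).

Definition Fhat_profinite : Type :=
  sup_topology (fun i : nat => Topological.class
    (initial_topology
      (Fproj i : Fhat n -> discrete_topology (downset (Kstage n i))))).

HB.instance Definition _ := Topological.on Fhat_profinite.

Section Dist.
Local Open Scope ring_scope.
Variable R : realType.

Definition differ a b : pred nat :=
  fun i => `[< carrier a `&` Kstage n i <> carrier b `&` Kstage n i >].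

Definition Fdist a b : R :=
  if pselect (exists i, differ a b i) is left h then 2 ^- ex_minn h else 0.

Lemma Fdist_ge a b i : differ a b i -> 2 ^- i <= Fdist a b.
Proof.
move=> abi; rewrite /Fdist; case: pselect => [h|]; last by case; exists i.
case: ex_minnP => m _ /(_ _ abi) mi.
by rewrite lef_pV2 ?posrE ?exprn_gt0// ler_weXn2l// ler1n.
Qed.

Lemma Fdist_ge0 a b : 0 <= Fdist a b.
Proof. by rewrite /Fdist; case: pselect => // h; rewrite invr_ge0 exprn_ge0. Qed.

Lemma Fdistxx a : Fdist a a = 0.
Proof. by rewrite /Fdist; case: pselect => // h; exfalso; case: h => i /asboolP. Qed.

Lemma Fdist_sym a b : Fdist a b = Fdist b a.
Proof.
have dC : differ a b = differ b a.
  by apply/funext => i; apply/asbool_equiv_eq; split=> h /esym.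
by rewrite /Fdist dC.
Qed.

Lemma Fdist_eq0 a b : Fdist a b = 0 -> a = b.
Proof.
move=> ab0; apply: downset_inj.
have ab i : carrier a `&` Kstage n i = carrier b `&` Kstage n i.
  apply: contrapT => abi; have := @Fdist_ge a b i (asboolT abi).
  by rewrite ab0 leNgt invr_gt0 exprn_gt0.
have sub c d : (forall i, carrier c `&` Kstage n i = carrier d `&` Kstage n i) ->
    carrier c `<=` carrier d.
  move=> cd w cw; have [i _ Kw] := (downsetP c).1 _ cw.
  by have [] : (carrier d `&` Kstage n i) w by rewrite -cd.
by apply/seteqP; split; exact: sub.
Qed.

Lemma Fdist_triangle b a c : Fdist a c <= Fdist a b + Fdist b c.
Proof.
rewrite {1}/Fdist; case: pselect => [h|_]; last by rewrite addr_ge0 ?Fdist_ge0.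
case: ex_minnP => m /asboolP acm _.
have [abm|abm] := pselect (carrier a `&` Kstage n m = carrier b `&` Kstage n m).
  have bcm : differ b c m by apply/asboolP; rewrite -abm.
  by rewrite (le_trans (Fdist_ge bcm))// lerDr Fdist_ge0.
have abm' : differ a b m by exact/asboolP.
by rewrite (le_trans (Fdist_ge abm'))// lerDl Fdist_ge0.
Qed.

End Dist.

End FreeHeyting.

Arguments Fn n : clear implicits.

Definition Fhat_metric (R : realType) (n : nat) : Type := Fhat n.

HB.instance Definition _ (R : realType) n := Choice.on (Fhat_metric R n).
HB.instance Definition _ (R : realType) n :=
  @isMetric.Build R (Fhat_metric R n) (@Fdist n R)
    (@Fdistxx n R) (@Fdist_eq0 n R) (@Fdist_sym n R) (@Fdist_triangle n R).

Lemma mdist_Fhat (R : realType) n (a b : Fhat_metric R n) :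
  mdist a b = Fdist R a b.
Proof. by []. Qed.

Definition is_metric (R : realType) (T : Type) (d : T -> T -> R) : Prop :=
  [/\ (forall x y, 0 <= d x y)%R,
      (forall x y, d x y = 0%R <-> x = y),
      (forall x y, d x y = d y x) &
      (forall x y z, d x z <= d x y + d y z)%R].

Definition metric_complete (R : realType) (M : metricType R) : Prop :=
  forall F : set_system M, ProperFilter F -> cauchy F -> exists l : M, F --> l.

(* A carries the restriction of the metric of M, so the inclusion of A in M is
   isometric by construction *)
Definition is_completion_of (R : realType) (M : metricType R) (A : set M) :
  Prop := dense A /\ metric_complete M.

(* Main.v *)
(* Two elements are at distance less than 2^-i iff they have the same trace on
   the finite stage K_n^i, so both topologies have the sets "same trace on K_n^i
   as a" as a base at a.  Traces of meets, joins and implications depend only on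
   the traces of the arguments, because K_n^i is decreasing in K_n; this gives
   continuity.  For compactness and completeness: an ultrafilter, or a Cauchy
   filter, decides for every point w whether almost all of its members contain w,
   and the points contained in almost all of them form the limit.  For density,
   every decreasing subset of a stage lies in F_n: it is a finite union of
   principal sets, and these are defined by de Jongh-style formulas, by
   induction on the stage. *)

Require Import Defs.
From mathcomp Require Import all_boot all_order all_algebra finmap.
From mathcomp Require Import all_classical all_reals all_analysis.

Local Open Scope classical_set_scope.

Set Implicit Arguments.
Unset Strict Implicit.
Unset Printing Implicit Defensive.

Import Order.TTheory GRing.Theory Num.Theory.

(** * Equality of traces on a stage, and its stability under the Heyting operations *)

Section Agreement.
Variable n : nat.
Implicit Types (a b c : Fhat n) (w u v : Defs.point n).

Definition agree (i : nat) a b : Prop :=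
  forall w, Kstage n i w -> (carrier a w <-> carrier b w).

Lemma agreeP i a b :
  agree i a b <-> carrier a `&` Kstage n i = carrier b `&` Kstage n i.
Proof.
split=> [ab|ab w Kw].
  by apply/seteqP; split=> w [wa Kw]; split=> //; apply/(ab w Kw).
have E : (carrier a `&` Kstage n i) w = (carrier b `&` Kstage n i) w.
  by rewrite ab.
split=> ?.
- by have [] : (carrier b `&` Kstage n i) w by rewrite -E.
- by have [] : (carrier a `&` Kstage n i) w by rewrite E.
Qed.

Lemma agree_Fproj i a b : agree i a b <-> Fproj i a = Fproj i b.
Proof.
split=> [/agreeP ab|ab]; first exact: downset_inj.
by apply/agreeP; have := congr1 (@carrier n _) ab.
Qed.

Lemma agree_leq i j a b : (i <= j)%N -> agree j a b -> agree i a b.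
Proof. by move=> ij ab w Kw; apply: ab; apply: subset_Kpred Kw. Qed.

(** The Kripke clause for implication: the principal set of such a [v] is itself a decreasing
    candidate in the union. Membership of [v] thus depends only on points below [v]. *)
Lemma carrier_dimp a b : carrier (dimp a b) =
  [set v | Kn n v /\ forall u, ple u v -> carrier a u -> carrier b u].
Proof.
apply/seteqP; split=> [v abv|v [Kv abv]].
  have [abK abd] := downsetP (dimp a b).
  split=> [|u uv au]; first exact: abK abv.
  have Ku : Kn n u.
    by have [d _ /ple_Kpred Kd] := abK _ abv; exists d => //; exact: Kd uv.
  by have [[]|] := (dimp_largest a b).1 u (abd _ _ Ku uv abv).
have cK : decreasing_in (Kn n) [set u | Kn n u /\ ple u v].
  split=> [u []//|u u' Ku uu' [Ku' u'v]]; split=> //.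
  exact: ple_trans_Kn uu' u'v.
apply: ((dimp_largest a b).2 (mk_downset cK)); last by split=> //; right.
move=> u [Ku uv]; have [au|au] := pselect (carrier a u); last by left.
by right; exact: abv.
Qed.

Lemma agree_dmeet i a a' b b' :
  agree i a a' -> agree i b b' -> agree i (dmeet a b) (dmeet a' b').
Proof.
by move=> aa' bb' w Kw; split=> -[wa wb];
  (split; [exact/(aa' w Kw)|exact/(bb' w Kw)]).
Qed.

Lemma agree_djoin i a a' b b' :
  agree i a a' -> agree i b b' -> agree i (djoin a b) (djoin a' b').
Proof.
move=> aa' bb' w Kw; split=> -[wa|wb];
  by [left; exact/(aa' w Kw)|right; exact/(bb' w Kw)].
Qed.

Lemma agree_dimp i a a' b b' :
  agree i a a' -> agree i b b' -> agree i (dimp a b) (dimp a' b').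
Proof.
move=> aa' bb' w Kw; rewrite !carrier_dimp.
split=> -[Kw' wab]; split=> // u uw au; have Ku := ple_Kpred Kw uw;
  by apply/(bb' u Ku)/wab => //; exact/(aa' u Ku).
Qed.

End Agreement.

(** * Metric and profinite topologies: continuity, compactness, completeness *)

Section Topology.
Variables (R : realType) (n : nat).
Local Notation M := (Fhat_metric R n).
Local Open Scope ring_scope.

Lemma Fdist_lt i (a b : Fhat n) : Fdist R a b < 2 ^- i <-> agree i a b.
Proof.
split=> [ab|ab].
  apply/agreeP; apply: contrapT => nab.
  by have := @Fdist_ge n R a b i (asboolT nab); rewrite leNgt ab.
rewrite /Fdist; case: pselect => [h|_]; last by rewrite invr_gt0 exprn_gt0.
case: ex_minnP => m /asboolP abm _.
have im : (i < m)%N.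
  by rewrite ltnNge; apply/negP => mi; apply/abm/agreeP; exact: agree_leq ab.
by rewrite ltf_pV2 ?posrE ?exprn_gt0// ltr_eXn2l// ltr1n.
Qed.

Lemma nbhs_FhatP (a : M) (U : set M) :
  nbhs a U <-> exists i, forall b, agree i a b -> U b.
Proof.
rewrite -metricType_numDomainType.filter_from_mdist_nbhs; split.
  (* This bound satisfies [e^-1 < 2 ^+ i] ([upper_nthrootP]), hence [2 ^- i <= e]. *)
  move=> [e /= e0 eU]; pose i := Num.bound e^-1; exists i => b ab.
  apply: eU; rewrite mdist_Fhat; apply: lt_le_trans ((Fdist_lt i a b).2 ab) _.
  rewrite -[leRHS]invrK lef_pV2 ?posrE ?exprn_gt0 ?invr_gt0//.
  by apply/ltW/upper_nthrootP.
move=> [i iU]; exists (2 ^- i); first by rewrite /= invr_gt0 exprn_gt0.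
by move=> b; rewrite mdist_Fhat => /Fdist_lt; exact: iU.
Qed.

Lemma continuous_agree (f : Fhat n -> Fhat n -> Fhat n) :
  (forall i a a' b b',
     agree i a a' -> agree i b b' -> agree i (f a b) (f a' b')) ->
  continuous (fun p : M * M => f p.1 p.2 : M).
Proof.
move=> fP [a b] U /nbhs_FhatP[i iU].
exists ([set a' : M | agree i a a'], [set b' : M | agree i b b']) => /=.
  by split; apply/nbhs_FhatP; exists i.
by move=> [a' b'] [/= aa' bb']; apply/iU/fP.
Qed.

(* The limit consists of the points that belong to almost all members of F;
   the finiteness of the stages makes the convergence hold on each of them. *)
Lemma cvg_deciding (F : set_system M) : ProperFilter F ->
  (forall w, F [set a | carrier a w] \/ F [set a | ~ carrier a w]) ->
  exists l : M, F --> l.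
Proof.
move=> FF dec; pose L := [set w | Kn n w /\ F [set a | carrier a w]].
have Ld : decreasing_in (Kn n) L.
  split=> [w []//|w w' Kw ww' [_ Fw']]; split=> //.
  by apply: filterS Fw' => a; exact: (downsetP a).2.
exists (mk_downset Ld) => U /nbhs_FhatP[i iU].
rewrite nbhs_filterE; apply: filterS iU _.
have /finite_fsetP[X XE] := @finite_Kpred n i.+1.
pose G w : set M := [set b : M | L w <-> carrier b w].
have FG : F (\bigcap_(w in [set` X]) G w).
  apply: filter_bigI => w wX.
  have Kw : Kn n w by exists i => //; rewrite /Kstage XE.
  have [Fw|Fw] := dec w.
    by apply: filterS (Fw) => b bw; split=> // _; split.
  apply: filterS (Fw) => b bw; split=> // -[_ Fw'].
  by have [a []] := filter_ex (filterI Fw' Fw).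
by apply: filterS FG => b bG w Kw; apply: bG; rewrite -XE.
Qed.

Lemma compact_Fhat : compact [set: M].
Proof.
rewrite compact_ultra => F FU _.
have [|l Fl] := @cvg_deciding F _; last by exists l.
by move=> w; exact: (in_ultra_setVsetC [set a : M | carrier a w]).
Qed.

Lemma complete_Fhat : metric_complete M.
Proof.
move=> F FF /cauchy_ballP Fc; apply: cvg_deciding => w.
have [[i _ Kw]|Kw] := pselect (Kn n w); last first.
  (* Junk points lie in no decreasing subset of [Kn n]. *)
  right; apply: filterS filterT => a _ /(downsetP a).1; exact: Kw.
have e0 : 0 < 2 ^- i :> R by rewrite invr_gt0 exprn_gt0.
(* All members of [B] share their trace on K_n^i with a single [a] in [A], so [a] decides [w] for
   them. *)
have [[A B] /= [FA FB] AB] := Fc _ e0.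
have [a Aa] := filter_ex FA.
have ab b : B b -> agree i a b.
  move=> Bb; apply/Fdist_lt; rewrite -mdist_Fhat.
  by have := AB (a, b) (conj Aa Bb); rewrite ballEmdist.
have [aw|aw] := pselect (carrier a w); [left|right];
  by apply: filterS FB => b /ab /(_ w Kw) /= [awb bwa]; auto.
Qed.

Lemma nbhs_Fhat_profinite (a : Fhat n) (U : set (Fhat n)) :
  nbhs (a : Fhat_profinite n) U <-> nbhs (a : M) U.
Proof.
split=> [aU|/nbhs_FhatP[i iU]].
  (* This convergence is the wanted inclusion of neighbourhood filters; [cvg_sup] reduces it to one
     projection at a time. *)
  have : nbhs (a : M) --> (a : Fhat_profinite n).
    apply/cvg_sup => i B; rewrite [X in X B]nbhsE => -[_ [[A _ <-] Aa] AB].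
    suff: nbhs (a : M) B by [].
    apply/nbhs_FhatP; exists i => b /agree_Fproj ab; apply: AB.
    by rewrite /= -ab.
  exact.
(* Trivial, but [cvg_sup] extracts from it that neighbourhoods for a single projection are profinite
   neighbourhoods. *)
have : nbhs (a : Fhat_profinite n) --> (a : Fhat_profinite n) by [].
move=> /cvg_sup/(_ i); apply; rewrite nbhsE.
exists (@Fproj n i @^-1` [set Fproj i a]).
  by split=> //; exists [set Fproj i a] => //; exact: discrete_open.
by move=> b /= ba; apply/iU/agree_Fproj.
Qed.

Lemma open_Fhat_profinite (U : set (Fhat n)) :
  @open M U <-> @open (Fhat_profinite n) U.
Proof.
by rewrite !openE; split=> Uo a /Uo; rewrite /interior => /nbhs_Fhat_profinite.
Qed.

End Topology.

(** * Definability of bounded decreasing sets, and density of the free algebra *)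

Section Density.
Variable n : nat.
Implicit Types (A B Y : set (Defs.point n)) (w u v : Defs.point n).

(** Phrased for plain sets, so that formulas can be written with set operations, without carrying
    proofs that they are decreasing. *)
Definition definable A : Prop := exists2 a, Fn n a & carrier a = A.

Definition himp A B : set (Defs.point n) :=
  [set v | Kn n v /\ forall u, ple u v -> A u -> B u].

Lemma heyting_subalgebra_Fn : heyting_subalgebra (Fn n).
Proof.
by split=> [S [[]]|S [[]]|a b aF bF S SC|a b aF bF S SC|a b aF bF S SC] //;
  have [[_ _ SI SU Simp] _] := SC; [apply: SI|apply: SU|apply: Simp];
  by [exact: aF SC|exact: bF SC].
Qed.

Lemma definable0 : definable set0.
Proof. by exists (dbot _) => //; case: heyting_subalgebra_Fn. Qed.

Lemma definable_Kn : definable (Kn n).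
Proof. by exists (dtop _) => //; case: heyting_subalgebra_Fn. Qed.

Lemma definable_gen i : definable (carrier (Fgen i)).
Proof. by exists (Fgen i) => //; apply: sub_gen_smallest; exists i. Qed.

Lemma definableI A B : definable A -> definable B -> definable (A `&` B).
Proof.
move=> [a aF <-] [b bF <-]; exists (dmeet a b) => //.
by case: heyting_subalgebra_Fn => _ _ F _ _; exact: F.
Qed.

Lemma definableU A B : definable A -> definable B -> definable (A `|` B).
Proof.
move=> [a aF <-] [b bF <-]; exists (djoin a b) => //.
by case: heyting_subalgebra_Fn => _ _ _ F _; exact: F.
Qed.

Lemma definable_himp A B : definable A -> definable B -> definable (himp A B).
Proof.
move=> [a aF <-] [b bF <-]; exists (dimp a b); last exact: carrier_dimp.
by case: heyting_subalgebra_Fn => _ _ _ _; exact.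
Qed.

Lemma definable_bigcup (T : choiceType) (s : seq T) (f : T -> set (Defs.point n)) :
  (forall x, x \in s -> definable (f x)) ->
  definable (\bigcup_(x in [set` s]) f x).
Proof.
move=> fs; rewrite bigcup_seq big_seq.
by elim/big_ind: _ => //; [exact: definable0|exact: definableU].
Qed.

(** The factor [Kn n] keeps the junk points out of an empty intersection. *)
Lemma definable_bigcap (T : choiceType) (s : seq T) (f : T -> set (Defs.point n)) :
  (forall x, x \in s -> definable (f x)) ->
  definable (Kn n `&` \bigcap_(x in [set` s]) f x).
Proof.
move=> fs; rewrite bigcap_seq.
elim: s fs => [|x s IH] fs; first by rewrite big_nil setIT; exact: definable_Kn.
rewrite big_cons setICA; apply: definableI; first exact/fs/mem_head.
by apply: IH => y ys; apply: fs; rewrite inE ys orbT.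
Qed.

Definition principal w : set (Defs.point n) := [set v | ple v w].

(** [Y] lies in the stage preceding the layer of [w], which does not contain [w]; so [below] is
    irreflexive on K_n. *)
Lemma Kpred_node d w : Kpred n d w -> exists beta (Y : {fset Defs.point n}),
  [/\ w = node beta Y, ~ [set` Y] w &
   exists2 e, (e < d)%N & [/\ decreasing_in (Kpred n e) [set` Y],
     (forall w', w' \in Y -> beta \subset valuation w') &
     (forall w', [set` Y] = principal w' -> beta <> valuation w')]].
Proof.
move=> /KpredP[e ed we]; have Kew := layer_fresh we.
case: we => beta [Y [wE [Yd _ bY Yb]]]; exists beta, Y; split=> //.
  by move=> /Yd.1.
by exists e.
Qed.

Lemma Kn_below d u v : Kpred n d v -> ple u v -> Kn n u.
Proof.
move=> dv /(ple_Kpred dv) du; exists d => //; exact: KpredS du.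
Qed.

(* w_(beta,Y) is the only new point, that is, point outside Y, of the set on
   the right: a minimal new point v has label beta and lies exactly above Y, so
   v = w_(beta,Y); a second new point would have label beta and lie exactly
   above the principal set of w_(beta,Y), which condition (iii) forbids. *)
Lemma principal_node (beta : {set 'I_n}) (Y : {fset Defs.point n}) :
  Kn n (node beta Y) ->
  principal (node beta Y) =
  (Kn n `&` \bigcap_(i in [set` enum beta]) carrier (Fgen i)) `&`
  himp ((\bigcup_(i in [set` enum (~: beta)%SET]) carrier (Fgen i)) `|`
        \bigcup_(w in [set` enum_fset Y]) himp (principal w) (below w))
       [set` Y].
Proof.
move=> KbY; have [d0 _ d0bY] := KbY.
have [_ [_ [/node_inj[<- <-] bYY [e _ [[YK Yd] bY _]]]]] := Kpred_node d0bY.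
apply/seteqP; split=> [v vbY|v [[Kv vb] [_ vimp]]].
  have Kv : Kn n v := Kn_below d0bY vbY.
  split; [split=> // i /= | split=> // u uv uU].
    rewrite mem_enum => ib; split=> //.
    by case: vbY => [/bY/fintype.subsetP|->//]; exact.
  have [//|uE] := ple_trans_Kn KbY uv vbY; exfalso.
  case: uU; rewrite uE => -[/= i].
    by rewrite mem_enum inE => /negP ib [_].
  (* Here [i] is an element of [Y]; the inner implication, tested at [i] itself, would put [i]
     strictly below itself. *)
  move=> wY [_] /(_ i) iP.
  have ii : below i i by apply: iP; [left|right].
  have [d] : Kn n i by apply: (Kn_below d0bY); left.
  move=> _ /Kpred_node[? [? [iE iY _]]]; apply: iY.
  by move: ii; rewrite {1}iE.
have [d _] := Kv; rewrite /Kstage.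
(* Induction on the stage of [v]: the points strictly below [v] inherit the hypotheses, hence
   already lie below [node beta Y]. *)
elim: d.+1 v Kv vb vimp => {d} [//|d IH] v Kv vb vimp Kdv.
have [g [Z [vE vZ [f fd [[ZK Zd] _ Zg]]]]] := Kpred_node Kdv.
have ZP u : u \in Z -> ple u (node beta Y).
  move=> uZ; have uv : ple u v by rewrite vE; left.
  have Ku := Kn_below Kdv uv; apply: IH => //.
  - by move=> i /vb; exact: (downsetP (Fgen i)).2.
  - by move=> u' u'u; apply: vimp; exact: ple_trans_Kn u'u uv.
  - by apply: subset_Kpred (ZK _ uZ).
have [vY|nvY] := pselect ([set` Y] v); [by left|right].
have gE : g = beta.
  apply/setP => i; apply/idP/idP => [ig|ib].
    apply: contra_notT nvY => ib; apply: vimp; [by right|left].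
    by exists i; rewrite /= ?mem_enum ?inE// vE; split=> //; rewrite -vE.
  by have := vb i; rewrite /= mem_enum => /(_ ib)[_]; rewrite vE.
(* If [u] were not below [v], every point below both would be strictly below [u]; so [v] would
   satisfy the premise of the outer implication and lie in [Y]. *)
have YZ u : u \in Y -> u \in Z.
  move=> uY; have [uv|uv] := pselect (ple u v).
    by case: uv => [|uv]; [rewrite vE|case: nvY; rewrite -uv].
  case: nvY; apply: vimp; [by right|right].
  exists u => //; split=> // u' u'v [//|u'E]; case: uv.
  by rewrite -u'E.
rewrite vE gE; congr node; apply/fsetP => u; apply/idP/idP => [uZ|/YZ//].
have [//|uE] := ZP u uZ; exfalso; apply: (Zg (node beta Y)) => //.
apply/seteqP; split=> [u'|u' [/YZ//|->]]; first exact: ZP.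
by rewrite -uE.
Qed.

Lemma decreasing_Kpred d A :
  decreasing_in (Kpred n d) A -> decreasing_in (Kn n) A.
Proof.
move=> [AK Ad]; split=> [w /AK|w w' _ ww' Aw'].
  by move=> /KpredS; exists d.
by apply: (Ad w w') => //; apply: ple_Kpred ww'; exact: AK.
Qed.

Lemma decreasing_principal w : Kn n w -> decreasing_in (Kn n) (principal w).
Proof.
move=> Kw; split=> [v|v v' _ vv' v'w]; last exact: ple_trans_Kn vv' v'w.
by have [d _ dw] := Kw; exact: Kn_below dw.
Qed.

(** In the induction step, [principal_node] uses only generators and the sets [Y], [principal w']
    and [below w'] for [w'] in [Y], all contained in [Kpred n d]. *)
Lemma definable_bounded d A :
  decreasing_in (Kn n) A -> A `<=` Kpred n d -> definable A.
Proof.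
elim: d A => [|d IH] A Ad AK.
  by rewrite (_ : A = set0); [exact: definable0|apply/seteqP; split].
have defP w : A w -> definable (principal w).
  move=> Aw; have Kw := Ad.1 _ Aw.
  have [beta [Y [wE _ [e ed [Yd _ _]]]]] := Kpred_node (AK _ Aw).
  have YK w' : w' \in Y -> Kpred n d w'.
    by move=> /Yd.1; apply: subset_Kpred; rewrite -ltnS.
  rewrite wE in Kw *; rewrite principal_node//.
  apply: definableI.
    by apply: definable_bigcap => i _; exact: definable_gen.
  apply: definable_himp; last by apply: IH => //; exact: decreasing_Kpred Yd.
  apply: definableU.
    by apply: definable_bigcup => i _; exact: definable_gen.
  apply: definable_bigcup => w' w'Y; have dw' := YK _ w'Y.
  have belowd : below w' `<=` Kpred n d.
    by move=> u uw'; apply: ple_Kpred dw' _; left.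
  apply: definable_himp; apply: IH => //.
  - by apply: decreasing_principal; exists d => //; exact: KpredS.
  - by move=> u; exact: ple_Kpred.
  - have [? [Y' [-> _ [e' _ [Y'd _ _]]]]] := Kpred_node dw'.
    exact: decreasing_Kpred Y'd.
have /finite_fsetP[X XE] := sub_finite_set AK (@finite_Kpred n d.+1).
rewrite (_ : A = \bigcup_(w in [set` enum_fset X]) principal w).
  by apply: definable_bigcup => w wX; apply: defP; rewrite XE.
apply/seteqP; split=> [w Aw|w [v vX wv]].
  by exists w; [rewrite XE in Aw|right].
have Av : A v by rewrite XE.
have Kv := Ad.1 _ Av.
by apply: (Ad.2 w v) => //; exact: (decreasing_principal Kv).1.
Qed.

Lemma dense_Fn (R : realType) : dense (Fn n : set (Fhat_metric R n)).
Proof.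
move=> O [a Oa]; rewrite openE => /(_ a Oa) /nbhs_FhatP[i iO].
(* Truncating [a] to K_n^i preserves its trace there; the bound is [i.+1] because [Kstage n i] is
   [Kpred n i.+1]. *)
have [|w []//|b bF bE] := @definable_bounded i.+1 (carrier a `&` Kstage n i).
  by apply: (@decreasing_Kpred i.+1); exact: downsetP (Fproj i a).
exists b; split=> //; apply: iO => w Kw; rewrite bE.
by split=> [aw|[]].
Qed.

End Density.

Theorem theorem4p10 (R : realType) (n : nat) (hn : (1 <= n)%N) :
  [/\ is_metric (@Fdist n R),
      compact [set: Fhat_metric R n] /\ hausdorff_space (Fhat_metric R n),
      (forall U : set (Fhat n),
         @open (Fhat_metric R n) U <-> @open (Fhat_profinite n) U),
      [/\ continuous (fun p : Fhat_metric R n * Fhat_metric R n =>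
            dmeet p.1 p.2 : Fhat_metric R n),
          continuous (fun p : Fhat_metric R n * Fhat_metric R n =>
            djoin p.1 p.2 : Fhat_metric R n) &
          continuous (fun p : Fhat_metric R n * Fhat_metric R n =>
            dimp p.1 p.2 : Fhat_metric R n)] &
      is_completion_of (Fn n : set (Fhat_metric R n))].
Proof.
split.
- split=> *; [exact: Fdist_ge0| |exact: Fdist_sym|exact: Fdist_triangle].
  by split=> [/Fdist_eq0//|->]; exact: Fdistxx.
- by split; [exact: compact_Fhat|exact: metric_hausdorff].
- exact: open_Fhat_profinite.
- split; apply: continuous_agree;
    [exact: agree_dmeet|exact: agree_djoin|exact: agree_dimp].
- by split; [exact: dense_Fn|exact: complete_Fhat].
Qed.
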